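(* Let $t\geq 4$ be an even integer and let $a,b,c\geq 1$ be integers with $a+b\geq t-1$. Put $v=a+b+c+1$ and let $L=\{1^a,2^b,t^c\}$, and suppose $t\leq \lfloor v/2\rfloor$. Then there exists a Hamiltonian path $H$ of $K_v$ with $\ell(H)=L$ if and only if the following condition holds: for every divisor $d$ of $v$, the number of elements of $L$ (counted with multiplicity) that are multiples of $d$ does not exceed $v-d$.
   Context: $K_v$ is the complete graph on the vertex set $\{0,1,\dots,v-1\}$. The length of an edge $[x,y]$ of $K_v$ is $\ell(x,y)=\min(|x-y|,\,v-|x-y|)$. For a subgraph $\Gamma$ of $K_v$, $\ell(\Gamma)$ is the multiset of lengths of all edges of $\Gamma$ (with multiplicity). The notation $\{1^{a},2^{b},t^{c}\}$ denotes the multiset consisting of $a$ copies of $1$, $b$ copies of $2$ and $c$ copies of $t$. (The paper phrases the claim as ''$\mathrm{BHR}(\{1^a,2^b,t^c\})$ holds'', where $\mathrm{BHR}(L)$, for a list $L$ of $v-1$ positive integers not exceeding $\lfloor v/2\rfloor$, is the assertion stated in the claim.) *)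

(* Defs.v *)
From mathcomp Require Import all_boot.
Set Implicit Arguments. Unset Strict Implicit. Unset Printing Implicit Defensive.

Definition edge_len (v x y : nat) : nat :=
  let d := if x <= y then y - x else x - y in minn d (v - d).

Definition ham_path (v : nat) (p : seq nat) : Prop := perm_eq p (iota 0 v).

Definition path_lengths (v : nat) (p : seq nat) : seq nat :=
  [seq edge_len v xy.1 xy.2 | xy <- zip p (behead p)].

Definition L_abc (a b c t : nat) : seq nat := nseq a 1 ++ nseq b 2 ++ nseq c t.

Definition has_ham_path_with_lengths (v : nat) (L : seq nat) : Prop :=
  exists p, ham_path v p /\ perm_eq (path_lengths v p) L.

Definition divisor_condition (v : nat) (L : seq nat) : Prop :=
  forall d, d %| v -> count (fun x => d %| x) L <= v - d.

(* Main.v *)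
Require Import Defs.
From mathcomp Require Import all_boot.
From mathcomp Require Import zify.

(** The divisor condition always holds here, so the point is to construct a Hamiltonian
    path.  Since t <= v/2, it suffices to order 0, ..., v - 1 so that consecutive entries
    differ by 1 (a times), 2 (b times) and t (c times).

    Write c = kt + r with r < t, and suppose first that a + b = t - 1, so v = t + c.  The
    residue classes mod t are "columns", of height k + 2 for the first r and k + 1 for
    the others.  Traverse them one after the other, alternately upwards and downwards:
    this uses exactly c steps of length t, and the other steps join the tops and the
    bottoms of columns in turn.  At the bottom, columns are ordered 0, ..., t - 1; at the
    top, the order is r, ..., t - 1, 0, ..., r - 1.  What remains is to order the columns
    so that the prescribed numbers of 1's and 2's occur.

    Larger a and b come from two insertions: a path starting at 0 can be preceded by a new
    smallest vertex (one more 1), and a new smallest vertex can be inserted between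
    neighbours 0 and 1 (one more 2), which creates such a pair again.  This leaves the
    cases a = 1, 2 with b >= t - 2.  For a = 1 the path consists of the even and the odd
    vertices, each of them arranged by the same column method with steps 1 and t/2. *)

Set Implicit Arguments.
Unset Strict Implicit.
Unset Printing Implicit Defensive.

(** * Absolute differences along a sequence *)

Definition ad (x y : nat) : nat := (x - y) + (y - x).

Lemma adC x y : ad x y = ad y x. Proof. exact: addnC. Qed.

Lemma adSS x y : ad x.+1 y.+1 = ad x y. Proof. by rewrite /ad !subSS. Qed.

Definition steps (p : seq nat) : seq nat :=
  if p is x :: q then pairmap ad x q else [::].

Lemma steps_cons2 x y p : steps (x :: y :: p) = ad x y :: steps (y :: p).
Proof. by []. Qed.

Lemma steps_cat x p y q :
  steps ((x :: p) ++ y :: q) = steps (x :: p) ++ ad (last x p) y :: steps (y :: q).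
Proof. exact: pairmap_cat. Qed.

Lemma steps_split p x q : steps (p ++ x :: q) = steps (rcons p x) ++ steps (x :: q).
Proof.
by case: p => [|y p] //; rewrite steps_cat rcons_cons -cats1 -cat_cons steps_cat -catA.
Qed.

Lemma steps_rcons2 p x y : steps (rcons (rcons p x) y) = rcons (steps (rcons p x)) (ad x y).
Proof.
case: p => [|z p] //; rewrite -(cats1 _ y) rcons_cons steps_cat last_rcons /=.
by rewrite cats1.
Qed.

Lemma steps_rev p : steps (rev p) = rev (steps p).
Proof.
elim: p => [|x [|y p] IH] //.
by rewrite steps_cons2 !rev_cons steps_rcons2 -rev_cons IH adC.
Qed.

Lemma steps_map g f p :
  (forall x y, ad (f x) (f y) = g (ad x y)) -> steps (map f p) = map g (steps p).
Proof.
move=> fE; case: p => [|x p] //=.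
by elim: p x => //= y p IH x; rewrite fE IH.
Qed.

(** * Realizations of a step multiset and the two insertions *)

(** Plain differences are used instead of cyclic lengths. Equality of multisets is tested by
    counting against every predicate, which turns each modification of a path into linear
    arithmetic. *)
Definition realizes (t a b c : nat) (p : seq nat) : Prop :=
  perm_eq p (iota 0 (a + b + c).+1) /\
  forall P : pred nat, count P (steps p) = a * P 1 + b * P 2 + c * P t.

Definition standard (t a b c : nat) : Prop := exists q, realizes t a b c (0 :: q).

Definition growable (t a b c : nat) : Prop :=
  exists q1 q2, realizes t a b c (q1 ++ 0 :: 1 :: q2).

Lemma realizes_rev t a b c p : realizes t a b c p -> realizes t a b c (rev p).
Proof.
case=> pp cp; split; first by rewrite perm_rev.
by move=> P; rewrite steps_rev count_rev.
Qed.

Lemma steps_mapS p : steps (map S p) = steps p.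
Proof. by rewrite (@steps_map id) ?map_id // => x y; apply: adSS. Qed.

Lemma perm_cons0_mapS p n : perm_eq p (iota 0 n) -> perm_eq (0 :: map S p) (iota 0 n.+1).
Proof. by move=> pp; rewrite /= perm_cons (iotaDl 1 0) perm_map. Qed.

Lemma standard_succ_growable t a b c : standard t a b c -> growable t a.+1 b c.
Proof.
case=> q [pp cp]; exists [::], (map S q); split.
  by rewrite !addSn; apply: (@perm_cons0_mapS (0 :: q)).
by move=> P; rewrite cat0s steps_cons2 (steps_mapS (0 :: q)) -[ad 0 1]/1 [LHS]/= cp; lia.
Qed.

Lemma standard_succ t a b c : standard t a b c -> standard t a.+1 b c.
Proof.
case=> q [pp cp]; exists (map S (0 :: q)); split.
  by rewrite !addSn; apply: (@perm_cons0_mapS (0 :: q)).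
by move=> P; rewrite steps_cons2 (steps_mapS (0 :: q)) -[ad 0 1]/1 [LHS]/= cp; lia.
Qed.

Lemma standard_addn t a b c n : standard t a b c -> standard t (n + a) b c.
Proof. by move=> st; elim: n => // n; apply: standard_succ. Qed.

Lemma growable_succ t a b c : growable t a b c -> growable t a b.+1 c.
Proof.
(* The shift turns [0, 1] into [1, 2], and the new 0 goes between them: a 1 is replaced by a 1 and a
   2. Reversing the path makes the new pair [1, 0] read [0, 1]. *)
case=> q1 [q2 [pp cp]]; exists (rev (2 :: map S q2)), (rev (map S q1)).
suff R : realizes t a b.+1 c (map S q1 ++ 1 :: 0 :: 2 :: map S q2).
  by move: (realizes_rev R); rewrite rev_cat !rev_cons -!cats1 -!catA.
split.
  rewrite addnS addSn; apply: perm_trans (perm_cons0_mapS pp).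
  rewrite map_cat.
  by apply/permP => P; rewrite /= !count_cat /=; lia.
move=> P; have := cp P; rewrite (steps_split q1) (steps_split _ 1) -map_rcons.
rewrite !steps_cons2 !count_cat -[2 :: _]/(map S (1 :: q2)) !steps_mapS.
rewrite -[ad 0 1]/1 -[ad 1 0]/1 -[ad 0 2]/2 ![count P (_ :: _)]/=; lia.
Qed.

Lemma growable_addn t a b c n : growable t a b c -> growable t a (n + b) c.
Proof. by move=> st; elim: n => // n; apply: growable_succ. Qed.

Lemma realizes_from1 t a b c q :
  realizes t a b c (1 :: q) -> realizes t a b.+1 c (0 :: map S (1 :: q)).
Proof.
case=> pp cp; split; first by rewrite addnS addSn; apply: perm_cons0_mapS.
by move=> P; rewrite steps_cons2 (steps_mapS (1 :: q)) -[ad 0 2]/2 [LHS]/= cp; lia.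
Qed.

(** Reversing the tail after [x] exchanges only one link. Both sides are sums so that no truncated
    subtraction occurs. *)
Lemma count_steps_rotate (P : pred nat) q x y z :
  count P (steps (q ++ x :: rev (y :: z))) + P (ad x y) =
  count P (steps (q ++ x :: y :: z)) + P (ad x (last y z)).
Proof.
have rE : rev (y :: z) = last y z :: rev (belast y z) by rewrite lastI rev_rcons.
rewrite !(steps_split q) !count_cat rE !steps_cons2 -rE steps_rev.
by rewrite ![count P (_ :: _)]/= count_rev; lia.
Qed.

Lemma map_iota_const (f : nat -> nat) lo n d :
  (forall i, lo <= i < lo + n -> f i = d) -> map f (iota lo n) = nseq n d.
Proof.
elim: n lo => //= n IH lo fE; rewrite fE ?IH // => [i|]; last by lia.
by move=> ?; apply: fE; lia.
Qed.

(** * Alternating traversals of columns *)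

Section Columns.

Variables (m : nat) (h : nat -> nat).

Definition col (i : nat) : seq nat := [seq i + m * j | j <- iota 0 (h i)].

Definition top (i : nat) : nat := i + m * (h i).-1.

Fixpoint columns (up : bool) (s : seq nat) : seq nat :=
  if s is i :: s' then (if up then col i else rev (col i)) ++ columns (~~ up) s'
  else [::].

(** Here [up] is the direction of column [i]: an upward column ends at its top, and the next one is
    then entered from its top. *)
Definition link (up : bool) (i j : nat) : nat :=
  if up then ad (top i) (top j) else ad i j.

Fixpoint links (up : bool) (i : nat) (s : seq nat) : seq nat :=
  if s is j :: s' then link up i j :: links (~~ up) j s' else [::].

Lemma colE i : 0 < h i -> col i = i :: [seq i + m * j | j <- iota 1 (h i).-1].
Proof. by rewrite /col; case: (h i) => //= n _; rewrite muln0 addn0. Qed.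

Lemma col_rconsE i :
  0 < h i -> col i = rcons [seq i + m * j | j <- iota 0 (h i).-1] (top i).
Proof.
rewrite /col /top; case: (h i) => // n _.
by rewrite -[n.+1]addn1 iotaD map_cat cats1 add0n addn1.
Qed.

Lemma steps_col i : steps (col i) = nseq (h i).-1 m.
Proof.
rewrite /col; case: (h i) => // n; elim: n 0 => // n IH k.
move: (IH k.+1) => /= ->; congr (_ :: _).
by rewrite /ad mulnS; lia.
Qed.

Lemma columns_head up i s : 0 < h i ->
  exists q, columns up (i :: s) = (if up then i else top i) :: q.
Proof.
move=> hi; case: up => /=; first by rewrite colE //; eexists.
by rewrite col_rconsE // rev_rcons; eexists.
Qed.

Lemma columns_last up i : 0 < h i ->
  exists q, (if up then col i else rev (col i)) = rcons q (if up then top i else i).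
Proof.
move=> hi; case: up; first by rewrite col_rconsE //; eexists.
by rewrite colE // rev_cons; eexists.
Qed.

Lemma count_steps_columns (P : pred nat) up i s :
  all (fun j => 0 < h j) (i :: s) ->
  count P (steps (columns up (i :: s))) =
  count P (links up i s) + sumn [seq (h j).-1 | j <- i :: s] * P m.
Proof.
have stE b j : count P (steps (if b then col j else rev (col j))) = (h j).-1 * P m.
  by case: b; rewrite ?steps_rev ?count_rev steps_col count_nseq mulnC.
elim: s up i => [|j s IH] up i.
  by rewrite /= cats0 stE; lia.
move=> /andP[hi hs]; have [q1 E1] := columns_last up hi.
have hj : 0 < h j by case/andP: hs.
have [q2 E2] := columns_head (~~ up) s hj.
have {IH} := IH (~~ up) j hs.
rewrite -[columns up _]/((if up then col i else rev (col i)) ++ columns (~~ up) (j :: s)).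
have := stE up i; rewrite E2 E1 => st1 st2.
rewrite -cats1 -catA cat1s steps_split -(cats1 q1) cats1 steps_cons2 count_cat.
rewrite st1 [count P (_ :: _)]/= st2 /= /link.
by case: up {E1 E2 st1 st2} => /=; lia.
Qed.

Lemma perm_columns up s : perm_eq (columns up s) (flatten [seq col i | i <- s]).
Proof.
elim: s up => //= i s IH up; apply: perm_cat => //.
by case: up; rewrite ?perm_rev.
Qed.

Lemma columns_cat up s1 s2 :
  columns up (s1 ++ s2) = columns up s1 ++ columns (up (+) odd (size s1)) s2.
Proof.
elim: s1 up => [|i s1 IH] up /=; first by rewrite addbF.
by rewrite IH catA; congr (_ ++ columns _ _); case: up; case: (odd _).
Qed.

End Columns.

(** * Columns of the residue classes modulo [m] *)

Definition height (m c i : nat) : nat := (c %/ m).+1 + (i < c %% m).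

(** With [a = 1] this sums the heights of all columns; with [a = 0] it counts the vertical steps,
    one fewer than the height in each column. *)
Lemma sumn_height a c m : 0 < m ->
  sumn [seq a + c %/ m + (i < c %% m) | i <- iota 0 m] = a * m + c.
Proof.
move=> m0; have : c %% m <= m by rewrite ltnW // ltn_mod.
have := divn_eq c m; move: (c %/ m) (c %% m) => k r cE rm.
have -> : iota 0 m = iota 0 (r + (m - r)) by rewrite subnKC.
rewrite iotaD map_cat sumn_cat.
rewrite (@map_iota_const _ 0 r (a + k).+1) ?(@map_iota_const _ (0 + r) (m - r) (a + k)); try lia.
rewrite !sumn_nseq mulSn -addnA -mulnDr subnKC // mulnDl; lia.
Qed.

(** Each [x < m + c] lies in column [x %% m] at level [x %/ m]; since the total sizes agree, nothing
    is repeated or left over. *)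
Lemma perm_flatten_col m c : 0 < m ->
  perm_eq (flatten [seq col m (height m c) i | i <- iota 0 m]) (iota 0 (m + c)).
Proof.
move=> m0.
have sizeE : size (flatten [seq col m (height m c) i | i <- iota 0 m]) = m + c.
  rewrite size_flatten /shape -map_comp -[X in _ = X + c]mul1n -(sumn_height 1 c m0).
  by congr sumn; apply: eq_map => i; rewrite /= size_map size_iota.
have sub : {subset iota 0 (m + c) <= flatten [seq col m (height m c) i | i <- iota 0 m]}.
  move=> x; rewrite mem_iota => /andP[_ xc].
  have xm : x %% m < m by rewrite ltn_mod.
  apply/flattenP; exists (col m (height m c) (x %% m)).
    by apply: map_f; rewrite mem_iota.
  apply/mapP; exists (x %/ m); last by rewrite {1}(divn_eq x m); lia.
  rewrite mem_iota /= add0n /height.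
  have := divn_eq x m; have := divn_eq c m; have : c %% m < m by rewrite ltn_mod.
  move: (x %/ m) (x %% m) (c %/ m) (c %% m) xm xc => a b k r bm xc rm cE xE.
  have : a <= k + 1 by nia.
  have [br|br] := ltnP b r => ak /=; first by lia.
  by have : a != k + 1; [apply/eqP => aE; nia | lia].
have sz : size (flatten [seq col m (height m c) i | i <- iota 0 m]) <= size (iota 0 (m + c)).
  by rewrite sizeE size_iota.
rewrite perm_sym; apply: uniq_perm; rewrite ?iota_uniq //.
  exact: leq_size_uniq (iota_uniq _ _) sub sz.
by case: (uniq_min_size (iota_uniq _ _) sub sz).
Qed.

(* The difference between two tops; both have been lowered by m * (c %/ m). *)
Definition gap (m r : nat) (up : bool) (x y : nat) : nat :=
  if up then ad (if x < r then x + m else x) (if y < r then y + m else y) else ad x y.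

Definition gaps (m r : nat) (up : bool) (f : nat -> nat) (i : nat) : nat :=
  gap m r (up (+) odd i) (f i) (f i.+1).

Lemma link_height m c up x y : link m (height m c) up x y = gap m (c %% m) up x y.
Proof.
by case: up => //=; rewrite /top /height /ad /=; do 2!case: ifP => _ /=; lia.
Qed.

Lemma links_mkseq m c up f lo n :
  links m (height m c) (up (+) odd lo) (f lo) [seq f i | i <- iota lo.+1 n] =
  [seq gaps m (c %% m) up f i | i <- iota lo n].
Proof.
elim: n lo => //= n IH lo; rewrite link_height; congr (_ :: _).
by rewrite -IH -[odd lo.+1]/(~~ odd lo) addbN.
Qed.

Definition column_order (m : nat) (f : nat -> nat) : Prop :=
  (forall i, i < m -> f i < m) /\
  (forall i j, i < j -> j < m -> f i <> f j).

Lemma column_order_perm m f : column_order m f -> perm_eq (mkseq f m) (iota 0 m).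
Proof.
case=> fm fI.
have u : uniq (mkseq f m).
  rewrite map_inj_in_uniq ?iota_uniq // => i j; rewrite !mem_iota /= add0n => im jm fE.
  by case: (ltngtP i j) => // ij; [case: (fI _ _ ij jm) | case: (fI _ _ ij im)].
have sub : {subset mkseq f m <= iota 0 m}.
  move=> x /mapP[i]; rewrite !mem_iota /= !add0n => im ->; exact: fm.
apply: uniq_perm; rewrite ?iota_uniq //.
by case: (uniq_min_size u sub) => //; rewrite size_mkseq size_iota.
Qed.

(** The vertical steps number [c] whatever the order of the columns, so only the gaps between
    consecutive columns depend on [f]. *)
Lemma column_path m c up f : 0 < m -> column_order m f ->
  let p := columns m (height m c) up (mkseq f m) in
  perm_eq p (iota 0 (m + c)) /\
  forall P, count P (steps p) =
    count P [seq gaps m (c %% m) up f i | i <- iota 0 m.-1] + c * P m.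
Proof.
move=> m0 fo p; have fp := column_order_perm fo; split.
  apply: perm_trans (perm_columns _ _ _ _) (perm_trans _ (perm_flatten_col c m0)).
  by apply: perm_flatten; apply: perm_map.
move=> P; rewrite /p.
have sE : mkseq f m = f 0 :: [seq f i | i <- iota 1 m.-1].
  by rewrite /mkseq; case: (m) m0.
rewrite {1}sE count_steps_columns; last by apply/allP => j _; rewrite /height.
rewrite -sE -{1}[up]addbF -[X in up (+) X]/(odd 0) links_mkseq; congr (_ + _ * _).
rewrite -[RHS](sumn_height 0 c m0) (perm_sumn (perm_map _ fp)).
by congr sumn; apply: eq_map => i.
Qed.

Definition gap_counts (m r : nat) (up : bool) (f : nat -> nat) (a b : nat) : Prop :=
  forall P : pred nat,
    count P [seq gaps m r up f i | i <- iota 0 m.-1] = a * P 1 + b * P 2.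

Lemma columns_realizes m a b c up f :
  0 < m -> column_order m f -> gap_counts m (c %% m) up f a b ->
  realizes m a b c (columns m (height m c) up (mkseq f m)).
Proof.
move=> m0 fo gc; have [pp cp] := column_path c up m0 fo.
(* Counting all gaps gives [m - 1 = a + b], hence the right number of vertices. *)
have := gc predT; rewrite count_predT size_map size_iota => abE.
have {}abE : m.-1 = a + b by rewrite abE !muln1.
by split; [rewrite (_ : _.+1 = m + c) //; lia | move=> P; rewrite cp gc].
Qed.

(** Two columns on the same side of the break are raised equally, so their tops are as far apart as
    their bottoms. *)
Lemma gap_same m r (up : bool) x y : (up -> (x < r) = (y < r)) -> gap m r up x y = ad x y.
Proof. by rewrite /gap; case: up => // /(_ isT) ->; case: ifP => _; rewrite /ad; lia. Qed.

Lemma standard_columns m a b c f :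
  0 < m -> column_order m f -> gap_counts m (c %% m) true f a b -> f 0 = 0 ->
  standard m a b c.
Proof.
move=> m0 fo gc f0; have := columns_realizes m0 fo gc.
case: m {fo gc} m0 => // m _; rewrite (_ : mkseq f m.+1 = f 0 :: [seq f i | i <- iota 1 m]) // f0.
have [//|q ->] := @columns_head m.+1 (height m.+1 c) true 0 [seq f i | i <- iota 1 m].
by exists q.
Qed.

Lemma realizes_columns_from1 m a b c f :
  0 < m -> column_order m f -> gap_counts m (c %% m) true f a b -> f 0 = 1 ->
  exists q, realizes m a b c (1 :: q).
Proof.
move=> m0 fo gc f0; have := columns_realizes m0 fo gc.
case: m {fo gc} m0 => // m _; rewrite (_ : mkseq f m.+1 = f 0 :: [seq f i | i <- iota 1 m]) // f0.
have [//|q ->] := @columns_head m.+1 (height m.+1 c) true 1 [seq f i | i <- iota 1 m].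
by exists q.
Qed.

Lemma mkseq_split2 (T : Type) (f : nat -> T) m i : i.+1 < m ->
  mkseq f m = mkseq f i ++ [:: f i, f i.+1 & [seq f j | j <- iota i.+2 (m - i.+2)]].
Proof.
move=> im; rewrite /mkseq -{1}(@subnKC i m); last by lia.
rewrite iotaD map_cat add0n; congr (_ ++ _).
by rewrite (_ : m - i = (m - i.+2).+2) //; lia.
Qed.

(** Column 0 is traversed downwards and ends at 0; column 1 is then entered at its bottom. *)
Lemma columns_meet01 m h up s1 s2 : (forall i, 0 < h i) ->
  up (+) odd (size s1) = false ->
  exists q1 q2, columns m h up (s1 ++ 0 :: 1 :: s2) = q1 ++ 0 :: 1 :: q2.
Proof.
move=> h0 upE; rewrite columns_cat upE.
rewrite -[columns _ _ false _]/(rev (col m h 0) ++ columns m h true (1 :: s2)).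
have [//|q ->] := @columns_head m h true 1 s2.
rewrite colE // rev_cons -cats1 -!catA cat1s catA.
by exists (columns m h up s1 ++ rev [seq 0 + m * j | j <- iota 1 (h 0).-1]), q.
Qed.

Lemma growable_columns m a b c up f i :
  column_order m f -> gap_counts m (c %% m) up f a b ->
  i.+1 < m -> f i = 0 -> f i.+1 = 1 -> up (+) odd i = false -> growable m a b c.
Proof.
move=> fo gc im fi fi1 upi; have m0 : 0 < m by lia.
have := columns_realizes m0 fo gc; rewrite (mkseq_split2 _ im) fi fi1.
have [//||q1 [q2 ->]] := @columns_meet01 m (height m c) up (mkseq f i)
  [seq f j | j <- iota i.+2 (m - i.+2)]; first by rewrite size_mkseq.
by exists q1, q2.
Qed.

(** * Column orders that start at column 0 *)

Ltac ifs := repeat case: ifP => ?; lia.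

(** The order [0, 1, ..., y], then [y + 2, y + 4, ...] to the end, and back through the remaining
    columns down to [y + 1]. *)
Definition uturn (t y i : nat) : nat :=
  if i < y then i
  else if i < y + uphalf (t - y) then 2 * i - y else y + 1 + 2 * (t - 1 - i).

Lemma uturn_order t y : y <= t -> column_order t (uturn t y).
Proof. by move=> yt; split=> [i it|i j ij jt]; rewrite /uturn; ifs. Qed.

Lemma iota4 n1 n2 n3 n4 : iota 0 (n1 + n2 + n3 + n4) =
  iota 0 n1 ++ iota n1 n2 ++ iota (n1 + n2) n3 ++ iota (n1 + n2 + n3) n4.
Proof. by rewrite !iotaD -!catA. Qed.

(** A link changes its length only when it crosses the break between [r - 1] and [r] in the top row,
    so all crossings must occur at the bottom, that is, at odd indices. If [r <= y + 1], the only
    possible crossing has index [r - 1], odd as [r] is even. Otherwise a 2-link crosses on the way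
    out and another on the way back, and the condition modulo 4 makes both indices odd. *)
Lemma uturn_counts t r y :
  ~~ odd t -> ~~ odd r -> y.+2 <= t ->
  (r <= y.+1 \/ (r + y) %% 4 = 0 \/ (r + y) %% 4 = 3) ->
  gap_counts t r true (uturn t y) y.+1 (t - 2 - y).
Proof.
move=> te re yt H P.
(* The four blocks are the initial run, the 2-links out, the turn, and the 2-links back. *)
rewrite (_ : t.-1 = y + (uphalf (t - y)).-1 + 1 + ((t - y)./2).-1); last by lia.
rewrite iota4 !map_cat !count_cat.
rewrite (@map_iota_const _ 0 y 1); last first.
  move=> i iy; rewrite /gaps gap_same; first by rewrite /uturn /ad; ifs.
  by rewrite /= => oi; rewrite /uturn; ifs.
rewrite (@map_iota_const _ y _ 2); last first.
  move=> i iy; rewrite /gaps gap_same; first by rewrite /uturn /ad; ifs.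
  by rewrite /= => oi; rewrite /uturn; ifs.
rewrite (@map_iota_const _ _ 1 1); last first.
  move=> i iy; rewrite /gaps gap_same; first by rewrite /uturn /ad; ifs.
  by rewrite /= => oi; rewrite /uturn; ifs.
rewrite (@map_iota_const _ _ _ 2); last first.
  move=> i iy; rewrite /gaps gap_same; first by rewrite /uturn /ad; ifs.
  by rewrite /= => oi; rewrite /uturn; ifs.
by rewrite !count_nseq; case: (P 1); case: (P 2); lia.
Qed.

(* Trades two 1's for two 2's, so that the turn can start two columns later: this
   changes the parity with which the 2-links cross the break of the top row. *)
Definition zigzag (t y i : nat) : nat :=
  if i == 1 then 2 else if i == 2 then 1 else uturn t y i.

Lemma zigzag_order t y : 3 <= y <= t -> column_order t (zigzag t y).
Proof.
move=> yt; have [f1 f2] := @uturn_order t y ltac:(lia).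
(* [zigzag] is [uturn] with positions 1 and 2 exchanged; both lie in the initial run. *)
have E i : zigzag t y i = uturn t y (if i == 1 then 2 else if i == 2 then 1 else i).
  by case: i => [|[|[|i]]] //; rewrite /zigzag /= /uturn; ifs.
split=> [i it|i j ij jt]; rewrite !E; first by apply: f1; ifs.
set i' := (X in uturn _ _ X); set j' := (X in _ <> uturn _ _ X).
have [ne im jm] : [/\ i' <> j', i' < t & j' < t] by rewrite /i' /j'; split; ifs.
by case: (ltngtP i' j') => // h e; [case: (f2 _ _ h jm) | case: (f2 _ _ h im)].
Qed.

(** Only the first three links change: [0, 1, 2, 3] becomes [0, 2, 1, 3]. These columns are on one
    side of the break because [4 <= r]. *)
Lemma zigzag_counts t r y :
  3 <= y -> y.+2 <= t -> 4 <= r ->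
  gap_counts t r true (uturn t y) y.+1 (t - 2 - y) ->
  gap_counts t r true (zigzag t y) y.-1 (t - y).
Proof.
move=> y3 yt r4 H P; have := H P.
rewrite (_ : t.-1 = 3 + (t - 4)); last by lia.
rewrite iotaD !map_cat !count_cat.
have -> : [seq gaps t r true (zigzag t y) i | i <- iota (0 + 3) (t - 4)] =
    [seq gaps t r true (uturn t y) i | i <- iota (0 + 3) (t - 4)].
  apply/eq_in_map => i; rewrite mem_iota => hi.
  by rewrite /gaps /zigzag; do ![case: eqP => ?; first by lia].
have E i : i <= y -> uturn t y i = i by move=> iy; rewrite /uturn; ifs.
have -> : [seq gaps t r true (zigzag t y) i | i <- iota 0 3] = [:: 2; 1; 2].
  rewrite -[iota 0 3]/[:: 0; 1; 2] !map_cons; congr [:: _, _ & [:: _]];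
    rewrite /gaps gap_same /zigzag ?E //= ?E //; lia.
have -> : [seq gaps t r true (uturn t y) i | i <- iota 0 3] = [:: 1; 1; 1].
  rewrite -[iota 0 3]/[:: 0; 1; 2] !map_cons; congr [:: _, _ & [:: _]];
    rewrite /gaps gap_same ?E //=; lia.
by rewrite /=; case: (P 1); case: (P 2); lia.
Qed.

Lemma gap_m m up x y : x < m -> y < m -> gap m m up x y = gap m 0 up x y.
Proof. by move=> xm ym; rewrite !gap_same // ?xm ?ym. Qed.

Lemma column_order_succ_gt0 m f i : column_order m f -> f 0 = 0 -> i.+1 < m -> 0 < f i.+1.
Proof.
case=> _ fI f0 im; case E: (f i.+1) => //.
by case: (fI 0 i.+1 _ im); rewrite ?f0 ?E.
Qed.

(* With a start at the bottom of column 0, bottom links never meet column 0 again, so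
   reflecting the other columns preserves them, while it moves the break between r - 1
   and r in the top row to the one between t - r and t + 1 - r. *)
Definition reflect_columns (t : nat) (f : nat -> nat) (i : nat) : nat :=
  if i == 0 then 0 else t - f i.

Lemma reflect_order t f : column_order t f -> f 0 = 0 -> column_order t (reflect_columns t f).
Proof.
move=> fo f0; have [fm fI] := fo; split=> [i it|i j ij jt]; rewrite /reflect_columns.
  case: eqP => i0; first by lia.
  by case: i i0 it => // i _ it; have := column_order_succ_gt0 fo f0 it; lia.
case: j ij jt => // j ij jt; have := column_order_succ_gt0 fo f0 jt; have := fm _ jt.
have [i0|i0] := eqVneq i 0; first by rewrite /=; lia.
have it : i < t by lia.
by have := fI _ _ ij jt; have := fm _ it; rewrite /=; lia.
Qed.

Lemma reflect_counts t r f a b :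
  column_order t f -> f 0 = 0 -> 0 < r < t ->
  gap_counts t (t + 1 - r) true f a b ->
  gap_counts t r true (reflect_columns t f) a b.
Proof.
move=> fo f0 rt H P; rewrite -H; congr count; apply/eq_in_map => i; rewrite mem_iota => hi.
have it : i.+1 < t by lia.
have [fm _] := fo.
have p1 := column_order_succ_gt0 fo f0 it; have l1 := fm _ it.
rewrite /gaps /reflect_columns /gap [i.+1 == 0]/=.
case: i hi it p1 l1 => [|i] hi it p1 l1 /=.
  by rewrite f0 /ad; ifs.
have it' : i.+1 < t by lia.
have p2 := column_order_succ_gt0 fo f0 it'; have l2 := fm _ it'.
by case: (odd i) => /=; rewrite /ad; ifs.
Qed.

(** The turn at [y = t - 2 - b] has the right counts. If its crossings have the wrong parity,
    [r + y] is 1 or 2 modulo 4; moving the turn to [y + 2 = t - b] makes it 3 or 0, and [zigzag]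
    restores the counts. *)
Lemma even_break_order t r b :
  4 <= t -> ~~ odd t -> ~~ odd r -> r < t -> 1 <= b <= t - 3 ->
  exists f, [/\ column_order t f, f 0 = 0 & gap_counts t r true f (t - 1 - b) b].
Proof.
move=> t4 te re rt bt.
have [good|bad] := boolP [|| r <= t - 2 - b + 1, (r + (t - 2 - b)) %% 4 == 0
                           | (r + (t - 2 - b)) %% 4 == 3].
  exists (uturn t (t - 2 - b)); split.
  - by apply: uturn_order; lia.
  - by rewrite /uturn; ifs.
  have -> : t - 1 - b = (t - 2 - b).+1 by lia.
  rewrite [X in gap_counts _ _ _ _ _ X](_ : b = t - 2 - (t - 2 - b)); last by lia.
  by apply: uturn_counts => //; lia.
exists (zigzag t (t - b)); split.
- by apply: zigzag_order; lia.
- by rewrite /zigzag /uturn /=; ifs.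
have -> : t - 1 - b = (t - b).-1 by lia.
rewrite [X in gap_counts _ _ _ _ _ X](_ : b = t - (t - b)); last by lia.
by apply: zigzag_counts; try lia; apply: uturn_counts => //; lia.
Qed.

Lemma standard_of_even_break t a b c :
  4 <= t -> ~~ odd t ->
  let r := if odd (c %% t) then (t + 1 - c %% t) %% t else c %% t in
  (exists f, [/\ column_order t f, f 0 = 0 & gap_counts t r true f a b]) ->
  standard t a b c.
Proof.
move=> t4 te /= [f [fo f0 gc]]; have t0 : 0 < t by lia.
have ct : c %% t < t by rewrite ltn_mod.
move: gc; case: ifP => [ro|_] gc; last exact: (standard_columns t0 fo gc f0).
apply: (standard_columns t0 (reflect_order fo f0)); last by [].
apply: reflect_counts => //; first by case: (c %% t) ro ct.
(* Remainder 1 reflects to a break at [t], which is no break at all and agrees with a break at 0. *)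
have [r1|r1] := eqVneq (c %% t) 1; last by rewrite modn_small in gc => //; lia.
move: gc; rewrite r1 addnK modnn => gc P; rewrite -gc; congr count.
apply/eq_in_map => i; rewrite mem_iota => hi; have [fm _] := fo.
by rewrite /gaps gap_m //; apply: fm; lia.
Qed.

Lemma even_reflect t r : ~~ odd t -> odd r -> r < t -> ~~ odd ((t + 1 - r) %% t).
Proof.
move=> te ro rt; have [->|r1] := eqVneq r 1; first by rewrite addnK modnn.
by rewrite modn_small; lia.
Qed.

Lemma standard_base t b c :
  4 <= t -> ~~ odd t -> 1 <= b <= t - 3 -> standard t (t - 1 - b) b c.
Proof.
move=> t4 te bt; apply: standard_of_even_break => //; apply: even_break_order => //.
  by case: ifP => ro; [apply: even_reflect; rewrite ?ltn_mod; lia | rewrite ro].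
by case: ifP => ro; rewrite ltn_mod; lia.
Qed.

(** A single 1 leaves none for [zigzag] to trade, hence the condition modulo 4. *)
Lemma standard_base1 t c :
  4 <= t -> ~~ odd t ->
  (if odd (c %% t) then (t + 1 - c %% t) %% t else c %% t) %% 4 = 0 ->
  standard t 1 (t - 2) c.
Proof.
move=> t4 te r4; apply: standard_of_even_break => //; exists (uturn t 0); split.
- exact: uturn_order.
- by rewrite /uturn; ifs.
rewrite -[t - 2]subn0; apply: uturn_counts; rewrite ?addn0 ?r4; by [lia | right; left].
Qed.

(** * Column orders with one or two steps of length 1 *)

Ltac eval_ifs := repeat first [rewrite ifT; [|by lia] | rewrite ifF; [|by lia]].

Ltac plain_links f :=
  move=> i hi; rewrite /gaps gap_same;
  [rewrite /f /ad; eval_ifs; ifs | move=> oi; rewrite /f; eval_ifs; ifs].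

(** In the top row column 0 follows column [m - 1], so links such as [m - 2] to 0 or [m - 1] to 1
    have length 2 there. *)
Lemma gap_top_down m r (up : bool) x y : up -> r <= x -> y < r ->
  gap m r up x y = ad x (y + m).
Proof. by rewrite /gap => -> rx ->; rewrite ltnNge rx. Qed.

Lemma gap_top_up m r (up : bool) x y : up -> x < r -> r <= y ->
  gap m r up x y = ad (x + m) y.
Proof. by rewrite /gap => -> -> ry; rewrite ltnNge ry. Qed.

Ltac top_links lem f :=
  move=> i hi; rewrite /gaps lem; try (rewrite /f /ad; eval_ifs; ifs); lia.

(* The 2-links of each order below run through the even columns and through the odd
   columns; the parity conditions say that they cross from r - 2 to r, or from r - 1 to
   r + 1, at the bottom. *)
Definition order_r1 (s p i : nat) : nat :=
  if i < p then 2 * (p - 1 - i)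
  else if i < p + s then 2 * (i - p) + 1 else 2 * (s - 1 - (i - p - s)).

Lemma order_r1P s p : p <= s -> column_order (2 * s) (order_r1 s p).
Proof. by move=> ps; split=> [i it|i j ij jt]; rewrite /order_r1; ifs. Qed.

Lemma order_r1_counts s p : odd s -> odd p -> p < s ->
  gap_counts (2 * s) (2 * p - 1) false (order_r1 s p) 2 (2 * s - 3).
Proof.
move=> so po ps P; rewrite (_ : (2 * s).-1 = p.-1 + 1 + s.-1 + (s - p)); last by lia.
rewrite iota4 !map_cat !count_cat.
rewrite (@map_iota_const _ 0 _ 2); last by plain_links order_r1.
rewrite (@map_iota_const _ _ 1 1); last by plain_links order_r1.
rewrite (@map_iota_const _ _ _ 2); last by plain_links order_r1.
rewrite (_ : s - p = 1 + (s - p).-1); last by lia.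
rewrite iotaD map_cat count_cat (@map_iota_const _ _ 1 1); last by plain_links order_r1.
rewrite (@map_iota_const _ _ _ 2); last by plain_links order_r1.
by rewrite !count_nseq; case: (P 1); case: (P 2); lia.
Qed.

(** The order [2p + 1, 2p + 3, ..., 2s - 1], then [2s - 2, ..., 2, 0], then [1, 3, ..., 2p - 1]. The
    odd columns are cut at the break, so among the 2-links only an even one can cross it. *)
Definition order_r3 (s p i : nat) : nat :=
  if i < s - p then 2 * p + 1 + 2 * i
  else if i < s - p + s then 2 * (s - 1 - (i - (s - p))) else 2 * (i - (s - p) - s) + 1.

Lemma order_r3P s p : p <= s -> column_order (2 * s) (order_r3 s p).
Proof. by move=> ps; split=> [i it|i j ij jt]; rewrite /order_r3; ifs. Qed.

Lemma order_r3_counts s p : odd p -> p < s ->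
  gap_counts (2 * s) (2 * p + 1) false (order_r3 s p) 2 (2 * s - 3).
Proof.
move=> po ps P; rewrite (_ : (2 * s).-1 = (s - p).-1 + 1 + s.-1 + p); last by lia.
rewrite iota4 !map_cat !count_cat.
rewrite (@map_iota_const _ 0 _ 2); last by plain_links order_r3.
rewrite (@map_iota_const _ _ 1 1); last by plain_links order_r3.
rewrite (@map_iota_const _ _ _ 2); last by plain_links order_r3.
rewrite (_ : iota _ p = iota ((s - p).-1 + 1 + s.-1) (1 + p.-1)); last by congr iota; lia.
rewrite iotaD map_cat count_cat.
rewrite (@map_iota_const _ _ 1 1); last by plain_links order_r3.
rewrite (@map_iota_const _ _ _ 2); last by plain_links order_r3.
by rewrite !count_nseq; case: (P 1); case: (P 2); lia.
Qed.

(** The order [4, 6, ..., 2s - 2, 0, 1, 2s - 1, ..., 5, 3, 2]. The links from [2s - 2] to 0 and from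
    1 to [2s - 1] wrap around in the top row; the starting direction [odd s] puts them there. *)
Definition order_r2 (s i : nat) : nat :=
  if i < s - 2 then 4 + 2 * i
  else if i < s then i - (s - 2)
  else if i < 2 * s - 1 then 2 * s - 1 - 2 * (i - s) else 2.

Lemma order_r2P s : 2 <= s -> column_order (2 * s) (order_r2 s).
Proof. by move=> s2; split=> [i it|i j ij jt]; rewrite /order_r2; ifs. Qed.

Lemma order_r2_counts s p : 2 <= s -> odd p -> p < s -> ~~ odd s \/ p = 1 ->
  gap_counts (2 * s) (2 * p) (odd s) (order_r2 s) 2 (2 * s - 3).
Proof.
move=> s2 po ps sp P; rewrite (_ : (2 * s).-1 = s - 2 + 1 + s.-1 + 1); last by lia.
rewrite iota4 !map_cat !count_cat.
rewrite (_ : count P [seq _ | i <- iota 0 _] = (s - 2) * P 2); last first.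
  have [->|s3] := eqVneq s 2; first by [].
  rewrite (_ : s - 2 = s - 3 + 1); last by lia.
  rewrite iotaD map_cat count_cat.
  rewrite (@map_iota_const _ 0 _ 2); last by plain_links order_r2.
  rewrite (@map_iota_const _ _ 1 2); last by top_links gap_top_down order_r2.
  by rewrite !count_nseq; case: (P 2); lia.
rewrite (@map_iota_const _ _ 1 1); last by plain_links order_r2.
rewrite (_ : s.-1 = 1 + (s - 2)); last by lia.
rewrite iotaD map_cat count_cat.
rewrite (@map_iota_const _ _ 1 2); last by top_links gap_top_up order_r2.
rewrite (@map_iota_const _ _ _ 2); last by plain_links order_r2.
rewrite (@map_iota_const _ _ 1 1); last by plain_links order_r2.
by rewrite !count_nseq; case: (P 1); case: (P 2); lia.
Qed.

(** The order [3, 5, ..., 2s - 3, 2s - 2, ..., 2, 0, 1, 2s - 1], whose last link wraps around in the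
    top row. *)
Definition order_rlast (s i : nat) : nat :=
  if i < s - 2 then 3 + 2 * i
  else if i < 2 * s - 2 then 2 * (s - 1 - (i - (s - 2)))
  else if i == 2 * s - 2 then 1 else 2 * s - 1.

Lemma order_rlastP s : 3 <= s -> column_order (2 * s) (order_rlast s).
Proof. by move=> s3; split=> [i it|i j ij jt]; rewrite /order_rlast; ifs. Qed.

Lemma order_rlast_counts s : 3 <= s ->
  gap_counts (2 * s) (2 * s - 1) true (order_rlast s) 2 (2 * s - 3).
Proof.
move=> s3 P; rewrite (_ : (2 * s).-1 = s - 3 + 1 + s.-1 + 2); last by lia.
rewrite iota4 !map_cat !count_cat.
rewrite (@map_iota_const _ 0 _ 2); last by plain_links order_rlast.
rewrite (@map_iota_const _ _ 1 1); last by plain_links order_rlast.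
rewrite (@map_iota_const _ _ _ 2); last by plain_links order_rlast.
rewrite -[2]/(1 + 1) iotaD map_cat count_cat.
rewrite (@map_iota_const _ _ 1 1); last by plain_links order_rlast.
rewrite (@map_iota_const _ _ 1 2); last by top_links gap_top_up order_rlast.
by rewrite !count_nseq; case: (P 1); case: (P 2); lia.
Qed.

Definition order_odd_even (s i : nat) : nat := if i < s then 2 * i + 1 else 2 * (i - s).

Lemma order_odd_evenP s : column_order (2 * s) (order_odd_even s).
Proof. by split=> [i it|i j ij jt]; rewrite /order_odd_even; ifs. Qed.

(** The only 1 is the link from [2s - 1] to 0 in the top row, at the even index [s - 1]. *)
Lemma order_odd_even_counts s p : odd s -> odd p -> p <= s ->
  gap_counts (2 * s) (2 * p - 1) true (order_odd_even s) 1 (2 * s - 2).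
Proof.
move=> so po ps P; rewrite (_ : (2 * s).-1 = s.-1 + 1 + s.-1 + 0); last by lia.
rewrite iota4 !map_cat !count_cat.
rewrite (@map_iota_const _ 0 _ 2); last by plain_links order_odd_even.
rewrite (@map_iota_const _ _ 1 1); last by top_links gap_top_down order_odd_even.
rewrite (@map_iota_const _ _ _ 2); last by plain_links order_odd_even.
by rewrite !count_nseq; case: (P 1); case: (P 2); rewrite /=; lia.
Qed.

(** The even columns once around upwards from [2p] to [2p - 2], then the odd ones once around
    downwards from [2p - 1] to [2p + 1]. The break is where both rounds start and end. *)
Definition order_twice_around (s p i : nat) : nat :=
  if i < s - p then 2 * (p + i)
  else if i < s then 2 * (i - (s - p))
  else if i < s + p then 2 * (p - 1 - (i - s)) + 1 else 2 * (s - 1 - (i - s - p)) + 1.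

Lemma order_twice_aroundP s p : p <= s -> column_order (2 * s) (order_twice_around s p).
Proof. by move=> ps; split=> [i it|i j ij jt]; rewrite /order_twice_around; ifs. Qed.

Lemma order_twice_around_counts s p : odd s -> odd p -> p < s ->
  gap_counts (2 * s) (2 * p) false (order_twice_around s p) 1 (2 * s - 2).
Proof.
move=> so po ps P; rewrite (_ : (2 * s).-1 = (s - p) + p.-1 + p + (s - p)); last by lia.
rewrite iota4 !map_cat !count_cat.
rewrite (_ : s - p = (s - p).-1 + 1); last by lia.
rewrite iotaD map_cat count_cat.
rewrite (@map_iota_const _ 0 _ 2); last by plain_links order_twice_around.
rewrite (@map_iota_const _ _ 1 2); last by top_links gap_top_down order_twice_around.
rewrite (@map_iota_const _ _ p.-1 2); last by plain_links order_twice_around.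
rewrite (_ : iota _ p = iota ((s - p).-1 + 1 + p.-1) (1 + p.-1)); last by congr iota; lia.
rewrite iotaD map_cat count_cat.
rewrite (@map_iota_const _ _ 1 1); last by plain_links order_twice_around.
rewrite (@map_iota_const _ _ p.-1 2); last by plain_links order_twice_around.
rewrite (_ : iota _ (_ + 1) = iota ((s - p).-1 + 1 + p.-1 + p) (1 + (s - p).-1));
  last by congr iota; lia.
rewrite iotaD map_cat count_cat.
rewrite (@map_iota_const _ _ 1 2); last by top_links gap_top_up order_twice_around.
rewrite (@map_iota_const _ _ _ 2); last by plain_links order_twice_around.
by rewrite !count_nseq; case: (P 1); case: (P 2); lia.
Qed.

(* Posa rotation: the end of the path, the top of column w, is joined to the vertex of
   column u on the same level, where a link of length m is dropped in exchange. *)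
Lemma rotate_columns m h u w A : 1 < h w <= h u ->
  let p := A ++ rev (col m h u) ++ col m h w in
  exists z, perm_eq (A ++ z) p /\
    forall P : pred nat,
      count P (steps (A ++ z)) + P m = count P (steps p) + P (ad u w).
Proof.
move=> hwu p; set n := (h w).-2.
have uE : col m h u = [seq u + m * j | j <- iota 0 n] ++
    [:: u + m * n, u + m * n.+1 & [seq u + m * j | j <- iota n.+2 (h u - n.+2)]].
  rewrite /col {1}(_ : h u = n + (h u - n.+2).+2); last by rewrite /n; lia.
  by rewrite iotaD map_cat.
set L := [seq _ | j <- iota 0 n] in uE; set B := [seq _ | j <- iota _ _] in uE.
have pE : p = (A ++ rev B) ++ [:: u + m * n.+1, u + m * n & rev L ++ col m h w].
  by rewrite /p uE rev_cat !rev_cons -!cats1 -!catA.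
exists (rev B ++ u + m * n.+1 :: rev (u + m * n :: rev L ++ col m h w)).
rewrite pE; split.
  by rewrite -!catA !perm_cat2l perm_cons perm_rev.
move=> P; have := count_steps_rotate P (A ++ rev B) (u + m * n.+1) (u + m * n) (rev L ++ col m h w).
rewrite -!catA; have -> : ad (u + m * n.+1) (u + m * n) = m by rewrite /ad mulnS; lia.
move=> ->; congr (_ + P _ : nat).
rewrite last_cat col_rconsE ?last_rcons; last by lia.
by rewrite /top (_ : (h w).-1 = n.+1) /ad /n; lia.
Qed.

(** * Growable paths with two steps of length 1 *)

(** The order for [c + 1], with remainder [2p + 1], ends with columns [2p - 3] and [2p - 1] of equal
    height. A rotation there trades one step of length [2s] for a 2, and [2 < p] keeps the pair
    [0, 1] out of its reach. *)
Lemma growable_rotated s p c : odd s -> odd p -> 2 < p < s -> c %% (2 * s) = 2 * p ->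
  growable (2 * s) 2 (2 * s - 2) c.
Proof.
move=> so po ps cE; set t := 2 * s; have t0 : 0 < t by rewrite /t; lia.
have c1E : c.+1 %% t = 2 * p + 1.
  by rewrite -addn1 -modnDml cE modn_small; rewrite /t; lia.
have fo := @order_r3P s p ltac:(lia).
have gc : gap_counts t (c.+1 %% t) false (order_r3 s p) 2 (t - 3).
  by rewrite c1E; apply: order_r3_counts; lia.
have [pp cp] := columns_realizes t0 fo gc.
move: pp cp; set h := height t c.+1; set f := order_r3 s p.
have fE : mkseq f t = mkseq f (2 * s - 2) ++ [:: 2 * p - 3; 2 * p - 1].
  rewrite (mkseq_split2 f (_ : (2 * s - 2).+1 < t)); last by rewrite /t; lia.
  rewrite (_ : t - _ = 0); last by rewrite /t; lia.
  by congr (_ ++ [:: _; _]); rewrite /f /order_r3; eval_ifs; lia.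
rewrite fE (mkseq_split2 f (_ : (2 * s - p - 1).+1 < 2 * s - 2)); last by lia.
have f0 : f (2 * s - p - 1) = 0 by rewrite /f /order_r3; eval_ifs; lia.
have f1 : f (2 * s - p - 1).+1 = 1 by rewrite /f /order_r3; eval_ifs; lia.
rewrite f0 f1; move: (mkseq f _) (size_mkseq f (2 * s - p - 1)) => s1 s1E.
set s2 := [seq f j | j <- _].
rewrite columns_cat size_cat /= s1E /s2 size_map size_iota.
rewrite (_ : odd _ = false) /=; last by lia.
have [q1 [q2 ->]] := @columns_meet01 t h false s1 s2 ltac:(by []) ltac:(rewrite s1E; lia).
rewrite cats0 => pp cp.
have hE x : x < 2 * p + 1 -> h x = (c.+1 %/ t).+2 by rewrite /h /height c1E => ->; lia.
have hw : 1 < h (2 * p - 1) <= h (2 * p - 3) by rewrite !hE ?leqnn //; lia.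
have [z [pz cz]] := @rotate_columns t h (2 * p - 3) (2 * p - 1) (q1 ++ 0 :: 1 :: q2) hw.
exists q1, (q2 ++ z); split.
  rewrite (_ : _ + _ + _ = 2 + (t - 3) + c.+1); last by rewrite /t; lia.
  by apply: perm_trans pp; rewrite -!cat_cons catA.
move=> P; have := cz P; rewrite cp -!cat_cons catA (_ : ad _ _ = 2); last by rewrite /ad; lia.
rewrite (_ : t - 3 = (t - 2).-1) /t; last by lia.
by case: (P 2); case: (P (2 * s)); move: (count P _); lia.
Qed.

Lemma growable_order_r1 s p c : odd s -> odd p -> p < s -> c %% (2 * s) = 2 * p - 1 ->
  growable (2 * s) 2 (2 * s - 3) c.
Proof.
move=> h0 h1 h2 rE; apply: (@growable_columns _ _ _ _ false (order_r1 s p) p.-1).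
- by apply: order_r1P; lia.
- by rewrite rE; apply: order_r1_counts.
- by lia.
- by rewrite /order_r1; clear rE; eval_ifs; lia.
- by rewrite /order_r1; clear rE; eval_ifs; lia.
- by clear rE; lia.
Qed.

Lemma growable_order_r2 s p c : 2 <= s -> odd p -> p < s -> ~~ odd s \/ p = 1 ->
  c %% (2 * s) = 2 * p -> growable (2 * s) 2 (2 * s - 3) c.
Proof.
move=> h0 h1 h2 h3 rE; apply: (@growable_columns _ _ _ _ (odd s) (order_r2 s) (s - 2)).
- by apply: order_r2P; lia.
- by rewrite rE; apply: order_r2_counts.
- by lia.
- by rewrite /order_r2; clear rE; eval_ifs; lia.
- by rewrite /order_r2; clear rE; eval_ifs; lia.
- by clear rE; lia.
Qed.

Lemma growable_order_r3 s p c : odd p -> p < s -> c %% (2 * s) = 2 * p + 1 ->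
  growable (2 * s) 2 (2 * s - 3) c.
Proof.
move=> h0 h1 rE; apply: (@growable_columns _ _ _ _ false (order_r3 s p) (2 * s - p - 1)).
- by apply: order_r3P; lia.
- by rewrite rE; apply: order_r3_counts.
- by lia.
- by rewrite /order_r3; clear rE; eval_ifs; lia.
- by rewrite /order_r3; clear rE; eval_ifs; lia.
- by clear rE; lia.
Qed.

Lemma growable_order_rlast s c : 3 <= s -> c %% (2 * s) = 2 * s - 1 ->
  growable (2 * s) 2 (2 * s - 3) c.
Proof.
move=> h0 rE; apply: (@growable_columns _ _ _ _ true (order_rlast s) (2 * s - 3)).
- by apply: order_rlastP; lia.
- by rewrite rE; apply: order_rlast_counts.
- by lia.
- by rewrite /order_rlast; clear rE; eval_ifs; lia.
- by rewrite /order_rlast; clear rE; eval_ifs; lia.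
- by clear rE; lia.
Qed.

Lemma growable_two t b c : 4 <= t -> ~~ odd t -> t - 2 <= b -> growable t 2 b c.
Proof.
move=> t4 te tb.
have ct : c %% t < t by rewrite ltn_mod; lia.
have [std|nstd] := eqVneq
    ((if odd (c %% t) then (t + 1 - c %% t) %% t else c %% t) %% 4) 0.
  (* A path from 0 with a single 1 exists here; prepending a vertex supplies the second 1. *)
  have -> : b = b - (t - 2) + (t - 2) by lia.
  by apply/growable_addn/standard_succ_growable/standard_base1.
have G b0 : b0 <= b -> growable t 2 b0 c -> growable t 2 b c.
  by move=> bb g; rewrite -(subnK bb); apply: growable_addn.
have [s tE] : exists s, t = 2 * s by exists t./2; lia.
subst t; have [r rD] : exists r, c %% (2 * s) = r by eexists.
rewrite rD in ct nstd.
have [r2|[r1|r3]] : r %% 4 = 2 \/ r %% 4 = 1 \/ r %% 4 = 3.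
- by clear rD; move: nstd; case: ifP => ro; lia.
- have [sp|sp] := boolP (~~ odd s || (r == 2)); last first.
    by apply: (G (2 * s - 2)) => //; apply: (@growable_rotated _ r./2); rewrite ?rD; clear rD; lia.
  apply: (G (2 * s - 3)); first by clear rD; lia.
  by apply: (@growable_order_r2 _ r./2); rewrite ?rD; clear rD; lia.
(* For even [s], [t + 1 - r] would be divisible by 4, which is the case already settled. *)
- have so : odd s.
    clear rD; move: nstd; rewrite (_ : odd r) /=; last by lia.
    have [->|rn1] := eqVneq r 1; first by rewrite addnK modnn.
    by rewrite [(_ - r) %% _]modn_small; lia.
  apply: (G (2 * s - 3)); first by clear rD; lia.
  (* Here [(r + 1) / 2 = s], outside the range of [order_r1]. *)
  have [rl|rl] := eqVneq r (2 * s - 1).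
    by apply: growable_order_rlast; rewrite ?rD //; clear rD; lia.
  by apply: (@growable_order_r1 _ r.+1./2); rewrite ?rD //; clear rD; lia.
- apply: (G (2 * s - 3)); first by clear rD; lia.
  by apply: (@growable_order_r3 _ r./2); rewrite ?rD; clear rD; lia.
Qed.

(** * Paths with steps 1 and [s] only *)

Lemma id_order s : column_order s id.
Proof. by split=> // i j ij _ /=; lia. Qed.

(** The break can be crossed only at the odd index [r - 1], hence at the bottom. *)
Lemma id_counts s r : ~~ odd r -> 0 < s -> gap_counts s r true id s.-1 0.
Proof.
move=> re s0 P; rewrite (@map_iota_const _ 0 _ 1).
  by rewrite count_nseq; lia.
by move=> i hi; rewrite /gaps gap_same /= => [|oi]; rewrite /ad; lia.
Qed.

Lemma standard_even s y : 0 < s -> ~~ odd (y %% s) -> standard s s.-1 0 y.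
Proof.
move=> s0 re; apply: (standard_columns s0 (id_order s)) => //.
exact: id_counts.
Qed.

Lemma standard_even_modulus s y : 0 < s -> ~~ odd s -> standard s s.-1 0 y.
Proof.
move=> s0 se; have [ro|re] := boolP (odd (y %% s)); last exact: standard_even.
apply: (standard_columns s0 (reflect_order (id_order s) _)) => //.
have : y %% s < s by rewrite ltn_mod.
move: (y %% s) ro => r ro rs; apply: reflect_counts => //; [exact: id_order | lia |].
by apply: id_counts; lia.
Qed.

(** The identity order works for [y + 1], whose remainder is even; a rotation at the last two
    columns then trades a step [s] for a 1. Since [s <= y], these columns have at least two
    vertices. *)
Lemma standard_rotated s y : 1 < s -> odd s -> odd (y %% s) -> s <= y -> standard s s 0 y.
Proof.
move=> s1 so ro sy; have s0 : 0 < s by lia.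
have ys : y %% s < s by rewrite ltn_mod.
(* Since [s] and [y %% s] are both odd, [y %% s + 1] is still below [s]. *)
have y1E : y.+1 %% s = (y %% s).+1.
  by rewrite -addn1 -modnDml modn_small addn1 //; lia.
have gc : gap_counts s (y.+1 %% s) true id s.-1 0 by apply: id_counts; rewrite ?y1E /=; lia.
have [pp cp] := columns_realizes s0 (id_order s) gc.
move: pp cp; have -> : mkseq id s = (0 :: iota 1 (s - 3)) ++ [:: s - 2; s - 1].
  rewrite /mkseq map_id -[0 :: _]/(iota 0 (1 + (s - 3))).
  rewrite (_ : [:: _; _] = iota (1 + (s - 3)) 2); last by rewrite /=; congr [:: _; _]; lia.
  by rewrite -[in iota (1 + _) 2](add0n (1 + _)) -iotaD; congr iota; lia.
rewrite columns_cat.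
rewrite (_ : true (+) odd _ = false); last by rewrite /= size_iota; lia.
have [//|q0 ->] := @columns_head s (height s y.+1) true 0 (iota 1 (s - 3)).
set h := height s y.+1.
rewrite (_ : columns s h false [:: s - 2; s - 1] =
    rev (col s h (s - 2)) ++ col s h (s - 1)); last first.
  by rewrite /columns cats0.
rewrite cat_cons => pp cp.
have hw : 1 < h (s - 1) <= h (s - 2).
  rewrite /h /height; have : 1 <= y.+1 %/ s by rewrite divn_gt0 //; lia.
  by move: (y.+1 %/ s) (y.+1 %% s) => k r k1; lia.
have [z [pz cz]] := @rotate_columns s h _ _ (0 :: q0) hw.
exists (q0 ++ z); split.
  rewrite (_ : s + 0 + y = s.-1 + 0 + y.+1); last by lia.
  exact: perm_trans pz pp.
move=> P; have := etrans (cz P) (congr1 (addn^~ _) (cp P)).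
rewrite (_ : ad _ _ = 1); last by rewrite /ad; lia.
by rewrite cat_cons; move: (count P _); case: (P 1); case: (P s); lia.
Qed.

Lemma ad_succl x : ad x.+1 x = 1. Proof. by rewrite /ad; lia. Qed.

Lemma steps_iota lo n : steps (iota lo n.+1) = nseq n 1.
Proof. by elim: n lo => // n IH lo; move: (IH lo.+1) => /= ->; rewrite adC ad_succl. Qed.

Lemma rev_iotaS lo n : rev (iota lo n.+1) = lo + n :: rev (iota lo n).
Proof. by rewrite -(addn1 n) iotaD rev_cat. Qed.

Lemma count_cons (T : Type) (P : pred T) x s : count P (x :: s) = P x + count P s.
Proof. by []. Qed.

(** The path is [0, s, s - 1, ..., y], followed by the pairs [i, s + i] for [i = y - 1, ..., 1],
    traversed up and down in turn. Equal heights mean that there is no break. *)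
Lemma standard_short s y : 0 < y < s -> standard s s.-1 0 y.
Proof.
move=> ys; set C := columns s (fun=> 2) true (rev (iota 1 y.-1)).
exists (s :: rev (iota y (s - y)) ++ C).
have pC : perm_eq C (iota 1 y.-1 ++ iota s.+1 y.-1).
  apply: perm_trans (perm_columns _ _ _ _) _.
  rewrite map_rev perm_sym; apply: perm_trans (perm_flatten _); last first.
    by rewrite perm_sym perm_rev.
  rewrite -[s.+1]addn1 iotaDl perm_sym.
  elim: (iota 1 _) => // i l IH; apply/permP => P.
  rewrite -[flatten _]/(col s (fun=> 2) i ++ flatten [seq col s (fun=> 2) j | j <- l]).
  have -> : col s (fun=> 2) i = [:: i; s + i] by rewrite /col /= muln0 muln1 addn0 addnC.
  have := permP IH P.
  rewrite !count_cat map_cons [count P [:: i; _]]/= [count P (i :: l)]/= [count P (s + i :: _)]/=.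
  by move=> ->; rewrite addn0 addnACA.
split.
  have e1 : 1 + y.-1 = y by lia.
  have e2 : y + (s - y) = s by lia.
  rewrite (_ : s.-1 + 0 + y = y.-1 + (s - y + y.-1.+1)); last by lia.
  rewrite -[iota 0 _]/(0 :: iota 1 _) perm_cons iotaD e1 iotaD e2.
  rewrite -[iota s _]/(s :: iota s.+1 y.-1).
  apply/permP => P; have := permP pC P.
  rewrite -cat_cons !count_cat [count P (_ :: _)]/= [count P (s :: iota _ _)]/= count_rev.
  by move=> ->; move: (count P (iota 1 _)) (count P (iota y _)) (count P (iota s.+1 _)) => *; lia.
move=> P.
have E : s :: rev (iota y (s - y)) = rev (iota y (s - y).+1).
  by rewrite rev_iotaS subnKC //; lia.
rewrite steps_cons2 count_cons (_ : ad 0 s = s) -?cat_cons; last by rewrite /ad; lia.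
case: (posnP y.-1) => [y1|y1].
  rewrite /C y1 cats0 E steps_rev count_rev steps_iota count_nseq.
  by case: (P 1); case: (P s); lia.
have rE : rev (iota 1 y.-1) = y.-1 :: rev (iota 1 y.-2).
  by rewrite -{1}(prednK y1) rev_iotaS add1n prednK.
have cC : count P (steps C) = y.-2 * P 1 + y.-1 * P s.
  rewrite /C rE count_steps_columns; last by apply/allP.
  congr (_ + _ * _); last first.
    rewrite (eq_map (g := fun=> 1)) // -rE map_rev sumn_rev.
    by rewrite (@map_iota_const _ _ _ 1) // sumn_nseq mul1n.
  have : forall b, links s (fun=> 2) b y.-1 (rev (iota 1 y.-2)) = nseq y.-2 1.
    move: (y.-1) y1 => [|n] // _ /=; elim: n => // n IH b.
    rewrite rev_iotaS add1n /= IH /link /top; congr (_ :: _); case: b => /=; rewrite /ad; lia.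
  by move=> ->; rewrite count_nseq mulnC.
have [q CE] : exists q, C = y.-1 :: q.
  by rewrite /C rE; apply: columns_head.
move: cC; rewrite CE => cC.
rewrite E (_ : iota y _ = y :: iota y.+1 (s - y)) // rev_cons -cats1 -catA steps_split.
rewrite -rev_cons steps_cons2 count_cat count_cons cC.
rewrite -[y :: _]/(iota y (s - y).+1) steps_rev count_rev steps_iota count_nseq.
rewrite (_ : ad y y.-1 = 1); last by rewrite /ad; lia.
by case: (P 1); case: (P s); lia.
Qed.

Lemma standard_weaken s x y x0 : standard s x0 0 y -> x0 <= x -> standard s x 0 y.
Proof. by move=> st le; rewrite -(subnK le); apply: standard_addn. Qed.

Lemma standard_one_s s x y : 1 < s -> s.-1 <= x ->
  [|| ~~ odd s, ~~ odd (y %% s) | s <= x] -> standard s x 0 y.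
Proof.
move=> s1 sx; have s0 : 0 < s by lia.
have [so|se] := boolP (odd s); last first.
  by move=> _; apply: standard_weaken (standard_even_modulus _ s0 se) sx.
have [ro|re] := boolP (odd (y %% s)); last first.
  by move=> _; apply: standard_weaken (standard_even s0 re) sx.
rewrite /= => sx'; have [sy|ys] := leqP s y.
  exact: standard_weaken (standard_rotated s1 so ro sy) sx'.
have y0 : 0 < y by case: (y) ro => //; rewrite mod0n.
by apply: standard_weaken (standard_short _) sx; rewrite y0.
Qed.

(** * Joining paths on the even and the odd vertices *)

Lemma perm_interleave n1 n2 : n2 <= n1 <= n2.+1 ->
  perm_eq ([seq 2 * i | i <- iota 0 n1] ++ [seq (2 * i).+1 | i <- iota 0 n2]) (iota 0 (n1 + n2)).
Proof.
move=> n12; apply: uniq_perm; rewrite ?iota_uniq //.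
  rewrite cat_uniq !map_inj_uniq ?iota_uniq => [|i j|i j]; try lia.
  rewrite andbT; apply/hasPn => x /mapP[i _ ->]; apply/negP => /mapP[j _]; lia.
move=> x; rewrite mem_cat mem_iota; apply/orP/idP.
  by case=> /mapP[i]; rewrite mem_iota => *; lia.
move=> xn; have [xo|xe] := boolP (odd x); [right | left]; apply/mapP; exists x./2;
  rewrite ?mem_iota; lia.
Qed.

(** Doubling turns steps 1 and [s] into 2 and [2s]. The even path, reversed, ends at 0 and the odd
    one starts at 1, so the only 1 joins them. *)
Lemma growable_interleave s x1 x2 y1 y2 :
  standard s x1 0 y1 -> standard s x2 0 y2 ->
  x2 + y2 <= x1 + y1 <= (x2 + y2).+1 -> growable (2 * s) 1 (x1 + x2) (y1 + y2).
Proof.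
case=> q1 [p1 c1] [q2 [p2 c2]] le.
exists (rev [seq 2 * i | i <- q1]), [seq (2 * i).+1 | i <- q2].
have E : rev [seq 2 * i | i <- q1] ++ 0 :: 1 :: [seq (2 * i).+1 | i <- q2] =
    rev [seq 2 * i | i <- 0 :: q1] ++ [seq (2 * i).+1 | i <- 0 :: q2].
  by rewrite !map_cons rev_cons -cats1 -catA.
split.
  rewrite E (_ : (1 + _ + _).+1 = (x1 + 0 + y1).+1 + (x2 + 0 + y2).+1); last by lia.
  apply: perm_trans (perm_interleave _); last by lia.
  by apply: perm_cat; rewrite ?perm_rev; apply: perm_map.
move=> P; rewrite steps_split steps_cons2 -rev_cons count_cat count_cons steps_rev count_rev.
rewrite -[0 :: map _ q1]/(map (fun i => 2 * i) (0 :: q1)).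
rewrite -[1 :: map _ q2]/(map (fun i => (2 * i).+1) (0 :: q2)).
rewrite !(@steps_map (fun d => 2 * d)); try by move=> x y; rewrite /ad; lia.
rewrite !count_map c1 c2 /= (_ : ad 0 1 = 1) //.
rewrite (_ : 2 * 1 = 2) //.
by case: (P 1); case: (P 2); case: (P (2 * s)); lia.
Qed.

(** [n1] and [n2] count the steps on the even and on the odd vertices, of which [y1] and [y2] have
    length [2 * s]. *)
Lemma growable_split s b c n1 n2 y1 y2 : 1 < s -> y1 + y2 = c ->
  n1 + n2 = b + c -> n2 <= n1 <= n2.+1 -> s.-1 + y1 <= n1 -> s.-1 + y2 <= n2 ->
  [|| ~~ odd s, ~~ odd (y1 %% s) | s + y1 <= n1] ->
  [|| ~~ odd s, ~~ odd (y2 %% s) | s + y2 <= n2] ->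
  growable (2 * s) 1 b c.
Proof.
move=> s1 yE nE n12 l1 l2.
have e1 : (s + y1 <= n1) = (s <= n1 - y1) by lia.
have e2 : (s + y2 <= n2) = (s <= n2 - y2) by lia.
rewrite e1 e2 => h1 h2; have -> : b = n1 - y1 + (n2 - y2) by clear h1 h2; lia.
rewrite -yE; apply: growable_interleave; last by clear h1 h2; lia.
  by apply: standard_one_s => //; clear h1 h2; lia.
by apply: standard_one_s => //; clear h1 h2; lia.
Qed.

Lemma growable_halves s b c y1 y2 : 1 < s -> y1 + y2 = c ->
  s.-1 + y1 <= uphalf (b + c) -> s.-1 + y2 <= (b + c)./2 ->
  [|| ~~ odd s, ~~ odd (y1 %% s) | s + y1 <= uphalf (b + c)] ->
  [|| ~~ odd s, ~~ odd (y2 %% s) | s + y2 <= (b + c)./2] ->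
  exists p, realizes (2 * s) 1 b c p.
Proof.
move=> s1 yE l1 l2 h1 h2.
have [q1 [q2 R]] : growable (2 * s) 1 b c.
  by apply: (@growable_split s b c (uphalf (b + c)) (b + c)./2 y1 y2) => //; clear; lia.
by exists (q1 ++ 0 :: 1 :: q2).
Qed.

Lemma modnMDl_small k s d : d < s -> (k * s + d) %% s = d.
Proof. by move=> ds; rewrite modnMDl modn_small. Qed.

Lemma realizes_one_even s b c : 1 < s -> ~~ odd s -> 2 * s - 2 <= b ->
  exists p, realizes (2 * s) 1 b c p.
Proof.
(* The even vertices take as many long steps as possible while keeping [s - 1] steps of length 2. *)
move=> s1 se sb; set y := minn c (uphalf (b + c) - s.-1).
by apply: (@growable_halves s b c y (c - y)); rewrite ?se // /y; lia.
Qed.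

(** The long steps are shared nearly equally, so that each share has an even remainder modulo [s] or
    its half has a spare 2. When [b] is too small for this, column orders modulo [2s] serve
    instead. *)
Lemma realizes_one_odd s b c : 1 < s -> odd s -> 2 * s - 2 <= b ->
  exists p, realizes (2 * s) 1 b c p.
Proof.
move=> s1 so sb; have t0 : 0 < 2 * s by lia.
have [k [r [cE rE rs]]] : exists k r, [/\ c = k * s + k * s + r, c %% (2 * s) = r & r < 2 * s].
  exists (c %/ (2 * s)), (c %% (2 * s)); split; rewrite ?ltn_mod //.
  by rewrite {1}(divn_eq c (2 * s)) mulnCA mulSn mul1n.
have [r0|[r2|[r3|r1]]] : r %% 4 = 0 \/ r %% 4 = 2 \/ r %% 4 = 3 \/ r %% 4 = 1
  by clear cE rE; lia.
- have e : (k * s + r./2) %% s = r./2 by apply: modnMDl_small; lia.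
  apply: (@growable_halves s b c (k * s + r./2) (k * s + r./2)); rewrite ?e //;
    move: (k * s) cE => ks cE; clear e rE; lia.
- have [bE|bn] := eqVneq b (2 * s - 2).
    have p1 : r./2 <= s by lia.
    exists (columns (2 * s) (height (2 * s) c) false (mkseq (order_twice_around s r./2) (2 * s))).
    apply: columns_realizes => //; first exact: order_twice_aroundP.
    rewrite rE bE {1}(_ : r = 2 * r./2); last by lia.
    by apply: order_twice_around_counts; clear cE rE; lia.
  have e1 : (k * s + r./2.+1) %% s = r./2.+1 by apply: modnMDl_small; clear cE rE; lia.
  have e2 : (k * s + r./2.-1) %% s = r./2.-1 by apply: modnMDl_small; clear cE rE; lia.
  apply: (@growable_halves s b c (k * s + r./2.+1) (k * s + r./2.-1)); rewrite ?e1 ?e2 //;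
    move: (k * s) cE => ks cE; clear e1 e2 rE; lia.
- have [bE|bn] := eqVneq b (2 * s - 2).
    have [||//|q R] := @standard_base1 (2 * s) c; try by clear cE rE; lia.
      rewrite rE (_ : odd r) /=; last by clear cE rE; lia.
      by rewrite [(_ - r) %% _]modn_small; clear cE rE; lia.
    by rewrite bE; exists (0 :: q).
  have e1 : (k * s + r./2.+1) %% s = r./2.+1 by apply: modnMDl_small; clear cE rE; lia.
  apply: (@growable_halves s b c (k * s + r./2.+1) (k * s + r./2)); rewrite ?e1 //;
    move: (k * s) cE => ks cE; clear e1 rE; try (by lia); apply/or3P; apply: Or33; lia.
(* For remainder 1 modulo 4 the sharing needs [b >= 2s]. The value [2s - 2] comes from a path
   starting at 1, and [2s - 1] from prepending 0 to its shift. *)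
have base : exists q, realizes (2 * s) 1 (2 * s - 2) c (1 :: q).
  apply: (realizes_columns_from1 t0 (order_odd_evenP s)).
    rewrite rE (_ : r = 2 * r./2.+1 - 1); last by clear cE rE; lia.
    by apply: order_odd_even_counts; clear cE rE; lia.
  by rewrite /order_odd_even; eval_ifs; lia.
have [bE|bn] := eqVneq b (2 * s - 2).
  by have [q R] := base; rewrite bE; exists (1 :: q).
have [bE|bn'] := eqVneq b (2 * s - 2).+1.
  by have [q R] := base; rewrite bE; eexists; apply: realizes_from1 R.
have e2 : (k * s + r./2) %% s = r./2 by apply: modnMDl_small; clear cE rE; lia.
apply: (@growable_halves s b c (k * s + r./2.+1) (k * s + r./2)); rewrite ?e2 //;
  move: (k * s) cE => ks cE; clear e2 rE; try (by lia); apply/or3P; apply: Or33; lia.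
Qed.

(** * Assembly of all cases *)

Lemma exists_realizes t a b c :
  4 <= t -> ~~ odd t -> 1 <= a -> 1 <= b -> t - 1 <= a + b ->
  exists p, realizes t a b c p.
Proof.
move=> t4 te a1 b1 ab.
have [a1E|an1] := eqVneq a 1.
  have -> : t = 2 * t./2 by lia.
  rewrite a1E; have [so|se] := boolP (odd t./2).
    by apply: realizes_one_odd => //; lia.
  by apply: realizes_one_even => //; lia.
have [abE|abn] := eqVneq (a + b) (t - 1).
  have [|q R] := @standard_base t b c t4 te; first by lia.
  by exists (0 :: q); rewrite (_ : a = t - 1 - b) //; lia.
suff [q1 [q2 R]] : growable t a b c by exists (q1 ++ 0 :: 1 :: q2).
have [a2E|an2] := eqVneq a 2; first by rewrite a2E; apply: growable_two; lia.
(* The base path takes as many 1's as it can while one is kept back to create the pair [0, 1], where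
   the missing 2's are inserted. As [a] is at least 3, [b0 <= t - 3]. *)
set b0 := t - 1 - minn a.-1 (t - 2).
have st : standard t (minn a.-1 (t - 2)) b0 c.
  by rewrite (_ : minn _ _ = t - 1 - b0); [apply: standard_base; lia | lia].
rewrite -(prednK a1) (_ : b = b - b0 + b0); last by lia.
rewrite (_ : a.-1 = a.-1 - minn a.-1 (t - 2) + minn a.-1 (t - 2)); last by lia.
exact/growable_addn/standard_succ_growable/standard_addn.
Qed.

(** * Cyclic lengths and the divisor condition *)

Lemma path_lengthsE v p : path_lengths v p = [seq minn d (v - d) | d <- steps p].
Proof.
rewrite /path_lengths; case: p => // x p.
elim: p x => //= y p IH x; rewrite -IH; congr (_ :: _).
by rewrite /edge_len /ad /=; case: ifP => xy; congr (minn _ (_ - _)); lia.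
Qed.

Lemma ham_path_of_realizes t a b c p :
  2 <= t -> t <= (a + b + c + 1)./2 -> realizes t a b c p ->
  has_ham_path_with_lengths (a + b + c + 1) (L_abc a b c t).
Proof.
move=> t2 tv [pp cp]; exists p; split; first by rewrite /ham_path addn1.
apply/permP => P; rewrite path_lengthsE count_map cp /L_abc !count_cat !count_nseq.
(* A difference of at most [t <= v / 2] is its own cyclic length. *)
have pE d : d <= t -> preim (fun e => minn e (a + b + c + 1 - e)) P d = P d.
  by move=> dt; congr (P _); lia.
by rewrite !pE // ?(ltnW t2) // !(mulnC (nat_of_bool _)) addnA.
Qed.

(** For [d = 1] all [v - 1] elements count; for [d = 2] the 1's do not, and [1 <= a]. Any other [d]
    counts at most the copies of [t], and only if it divides [t]; then [d <= t <= a + b + 1]. *)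
Lemma divisor_condition_L t a b c :
  1 <= a -> 1 <= t -> t - 1 <= a + b -> divisor_condition (a + b + c + 1) (L_abc a b c t).
Proof.
move=> a1 t1 ab d dv; rewrite /L_abc !count_cat !count_nseq.
have d0 : 0 < d by case: d dv => //; rewrite dvd0n addn1.
have [->|d1] := eqVneq d 1; first by rewrite !dvd1n; lia.
rewrite dvdn1 (negPf d1).
have [d2|d2] := boolP (d %| 2).
  have := dvdn_leq (isT : 0 < 2) d2; case: (d %| t); lia.
have [dt|dt] := boolP (d %| t); last by have := dvdn_leq _ dv; lia.
by have := dvdn_leq t1 dt; lia.
Qed.

Theorem theorem1p5 (t a b c : nat) :
  4 <= t -> ~~ odd t -> 1 <= a -> 1 <= b -> 1 <= c -> t - 1 <= a + b ->
  t <= (a + b + c + 1)./2 ->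
  (has_ham_path_with_lengths (a + b + c + 1) (L_abc a b c t) <->
   divisor_condition (a + b + c + 1) (L_abc a b c t)).
Proof.
move=> t4 te a1 b1 c1 ab tv; split=> _.
  by apply: divisor_condition_L => //; lia.
have [p R] := exists_realizes c t4 te a1 b1 ab.
by apply: ham_path_of_realizes R; lia.
Qed.
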